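(* Let $H$ be an abelian group (written multiplicatively) and let $\mathbb{K}=H\cup\{0\}$ be the monoid obtained by adjoining an absorbing element $0$ to $H$. Let $s:\mathbb{K}\to\mathbb{K}$ be a retraction, i.e. a map with $s\circ s=s$, that commutes with its conjugates for the action of $H$ by multiplication on $\mathbb{K}$. If $s(0)\neq 0$, then the operation $$x+y=\begin{cases} y & \text{if } x=0,\\ s(0)^{-1}\,x\,s\big(s(0)\,y\,x^{-1}\big) & \text{if } x\neq 0\end{cases}$$ defines a commutative monoid law on $\mathbb{K}$. With this law as addition, the monoid $\mathbb{K}$ (with its given multiplication) becomes a commutative semi-field of characteristic $1$.
   Context: For $h\in H$ let $R_h:\mathbb{K}\to\mathbb{K}$ be $R_h(x)=hx$ (with $R_h(0)=0$). The conjugates of $s$ are the maps $R_h\circ s\circ R_h^{-1}$, $h\in H$; the hypothesis is that $s$ commutes (under composition) with each of them. A semi-ring $(R,+,\cdot)$ is a non-empty set $R$ such that $(R,+)$ is a commutative monoid with neutral element $0$, $(R,\cdot)$ is a monoid with identity $1$, multiplication distributes over addition on both sides, $r\cdot 0=0\cdot r=0$ for all $r$, and $0\neq 1$. It is of characteristic $1$ when $1+1=1$. A (commutative) semi-field is a semi-ring whose non-zero elements form a commutative group under multiplication. *)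

(* Defs.v *)
From HB Require Import structures.
From mathcomp Require Import all_boot.

Set Implicit Arguments.
Unset Strict Implicit.
Unset Printing Implicit Defensive.

Local Open Scope group_scope.

Definition comm_monoid (R : Type) (op : R -> R -> R) (e : R) : Prop :=
  [/\ associative op, commutative op & left_id e op].

Definition comm_group_on (R : Type) (P : R -> Prop) (op : R -> R -> R) (e : R)
    : Prop :=
  [/\ P e /\ (forall x y, P x -> P y -> P (op x y)),
      forall x y z, P x -> P y -> P z -> op x (op y z) = op (op x y) z,
      forall x y, P x -> P y -> op x y = op y x,
      forall x, P x -> op e x = x
    & forall x, P x -> exists2 y, P y & op y x = e].

(* The library's nzSemiRingType bundles these axioms with the operations; here
   they are a predicate, since the addition depends on the map s. *)
Definition semiring (R : Type) (add : R -> R -> R) (zero : R)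
    (mul : R -> R -> R) (one : R) : Prop :=
  [/\ comm_monoid add zero,
      [/\ associative mul, left_id one mul & right_id one mul],
      left_distributive mul add /\ right_distributive mul add,
      left_zero zero mul /\ right_zero zero mul
    & zero <> one].

Definition comm_semifield (R : Type) (add : R -> R -> R) (zero : R)
    (mul : R -> R -> R) (one : R) : Prop :=
  semiring add zero mul one /\
  comm_group_on (fun x => x <> zero) mul one.

Definition characteristic1 (R : Type) (add : R -> R -> R) (one : R) : Prop :=
  add one one = one.

(* Some embeds H; None is the adjoined absorbing element. *)
Definition adjoin0 (H : Type) : Type := option H.

HB.instance Definition _ (H : choiceType) := Choice.on (adjoin0 H).

Definition zero {H : Type} : adjoin0 H := None.

Section Adjoin0.
Variable H : groupType.

Definition mul0 (x y : adjoin0 H) : adjoin0 H :=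
  if x is Some a then if y is Some b then Some (a * b) else zero else zero.

(* Total inverse with the junk value 0^-1 = 0. *)
Definition inv0 (x : adjoin0 H) : adjoin0 H :=
  if x is Some a then Some a^-1 else zero.

Fact mul0A : associative mul0.
Proof. by move=> [a|] [b|] [c|] //=; rewrite mulgA. Qed.

Fact mul01 : left_id (Some 1) mul0.
Proof. by move=> [a|] //=; rewrite mul1g. Qed.

Fact mul10 : right_id (Some 1) mul0.
Proof. by move=> [a|] //=; rewrite mulg1. Qed.

HB.instance Definition _ := isMonoid.Build (adjoin0 H) mul0A mul01 mul10.
HB.instance Definition _ := hasInv.Build (adjoin0 H) inv0.

Definition scale (h : H) (x : adjoin0 H) : adjoin0 H := (Some h : adjoin0 H) * x.

Fact scaleK h : cancel (scale h) (scale h^-1).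
Proof.
by case=> [a|] //; congr Some; rewrite mulgA mulVg mul1g.
Qed.

Fact scaleVK h : cancel (scale h^-1) (scale h).
Proof. by move=> x; have := scaleK h^-1 x; rewrite invgK. Qed.

(* scale h^-1 is the inverse map of scale h (scaleK, scaleVK). *)
Definition conjugate (h : H) (s : adjoin0 H -> adjoin0 H) :
    adjoin0 H -> adjoin0 H :=
  scale h \o s \o scale h^-1.

Definition commutes_with_conjugates (s : adjoin0 H -> adjoin0 H) : Prop :=
  forall h : H, s \o conjugate h s =1 conjugate h s \o s.

Definition retraction_add (s : adjoin0 H -> adjoin0 H) (x y : adjoin0 H) :
    adjoin0 H :=
  if x == zero then y else (s zero)^-1 * x * s (s zero * y * x^-1).

End Adjoin0.

(* Main.v *)
Require Import Defs.
From mathcomp Require Import all_boot.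

(** Write [c = s 0], an element of [H].  For a nonzero [a], the translation
    [y |-> a + y] is the conjugate of [s] by [c^-1 * a]
    ([retraction_addE]); so adding elements of [H] amounts to composing
    conjugates of [s].

    All conjugates of [s] commute with one another, hence so do all
    translations: [x + (y + z) = y + (x + z)] ([retraction_addCA]).  Moreover
    the factor [c^-1] normalises the translation by [a] to send [0] to [a], so
    that [x + 0 = x].  Taking [z = 0] in the left-commutation gives
    commutativity, and left-commutation together with commutativity gives
    associativity.

    Distributivity holds because multiplying by [h] carries the conjugate of [s]
    by [g] to the conjugate by [h * g].  Finally [1 + 1 = 1] comes from
    idempotence: the translation by [1] is a conjugate of [s], hence a
    retraction, and [1] lies in its image, as the image of [0]. *)

Set Implicit Arguments.
Unset Strict Implicit.
Unset Printing Implicit Defensive.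

Local Open Scope group_scope.

Section Scale.
Variable H : groupType.
Implicit Types (g h : H) (x y : adjoin0 H) (s : adjoin0 H -> adjoin0 H).

Lemma scaleM g h x : scale g (scale h x) = scale (g * h) x.
Proof. exact: mulgA. Qed.

(** Conjugation is a left action of [H] on self-maps: the conjugate by [g * h]
    is the one by [h] conjugated again by [g].  Evaluating at [scale g x]
    absorbs the inverse map, and gives the distributivity of the
    multiplication over the addition below. *)
Lemma conjugate_scale g h s x :
  conjugate (g * h) s (scale g x) = scale g (conjugate h s x).
Proof. by rewrite /conjugate /= !scaleM invgM -mulgA mulVg mulg1. Qed.

(** Transporting by [scale g] reduces a pair of conjugates, by [g] and [h], to
    the pair formed by [s] and its conjugate by [g^-1 * h]. *)
Lemma conjugates_commute s g h x :
  commutes_with_conjugates s ->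
  conjugate g s (conjugate h s x) = conjugate h s (conjugate g s x).
Proof.
move=> s_comm.
have transport y :
    conjugate h s (scale g y) = scale g (conjugate (g^-1 * h) s y).
  by rewrite -conjugate_scale mulgA mulgV mul1g.
have := congr1 (scale g) (s_comm (g^-1 * h) (scale g^-1 x)).
rewrite /= -!transport => eq_sh; rewrite -[x in LHS](scaleVK g) transport.
by rewrite -[RHS]eq_sh {1}/conjugate /= scaleK.
Qed.

Lemma conjugate_idem h s : idempotent_fun s -> idempotent_fun (conjugate h s).
Proof. by move=> s_retr x; rewrite /conjugate /= scaleK [s (s _)]s_retr. Qed.

Lemma mul0C : (forall a b : H, a * b = b * a) -> commutative (@mul0 H).
Proof. by move=> Hab [a|] [b|] //=; rewrite Hab. Qed.

Lemma adjoin0_comm_group :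
  (forall a b : H, a * b = b * a) ->
  comm_group_on (fun x : adjoin0 H => x <> zero) *%g 1.
Proof.
move=> Hab; split.
- by split=> // [[a|]] [b|].
- by move=> x y z _ _ _; apply: mulgA.
- by move=> x y _ _; apply: mul0C.
- by move=> x _; apply: mul1g.
- by case=> [a|] // _; exists (Some a^-1) => //; congr Some; apply: mulVg.
Qed.

End Scale.

Section RetractionAddition.
Variables (H : groupType) (Hab : forall a b : H, a * b = b * a).
Variables (s : adjoin0 H -> adjoin0 H) (c : H) (s0E : s zero = Some c).
Implicit Types (a h : H) (x y z : adjoin0 H).

Local Notation "x +s y" := (retraction_add s x y) (at level 50).

Lemma retraction_add0l : left_id zero (retraction_add s).
Proof. by []. Qed.

(** In the formula for the sum, [c] enters as [s 0]; since [H] is commutative,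
    the inner factor [c * a^-1] is the inverse of the outer factor [c^-1 * a],
    which makes the translation a conjugate. *)
Lemma retraction_addE a y : Some a +s y = conjugate (c^-1 * a) s y.
Proof.
rewrite /retraction_add s0E /conjugate /=; congr ((_ : adjoin0 H) * s _).
case: y => [b|] //; congr Some.
by rewrite invgM invgK Hab mulgA.
Qed.

(** The translation by [a] sends [0] to [c^-1 * a * s 0], which is [a]. *)
Lemma retraction_add0r : right_id zero (retraction_add s).
Proof.
case=> [a|] //; rewrite retraction_addE /conjugate /=.
by rewrite [scale _ zero]/(zero) s0E; congr Some; rewrite -mulgA Hab mulgK.
Qed.

Lemma retraction_mulDr (x : adjoin0 H) : {morph *%g x : y z / y +s z}.
Proof.
case: x => [h|] // [a|] z //.
change (scale h (Some a +s z) = Some (h * a) +s scale h z).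
by rewrite !retraction_addE -conjugate_scale !mulgA (Hab h).
Qed.

Lemma retraction_mulDl : left_distributive *%g (retraction_add s).
Proof.
move=> x y z; rewrite -![_ * z]/(mul0 _ z) !(mul0C Hab _ z).
exact: retraction_mulDr.
Qed.

Hypothesis s_comm : commutes_with_conjugates s.

Lemma retraction_addCA : left_commutative (retraction_add s).
Proof.
by move=> [a|] [b|] z //; rewrite !retraction_addE conjugates_commute.
Qed.

Lemma retraction_addC : commutative (retraction_add s).
Proof.
by move=> x y; rewrite -{1}[y]retraction_add0r retraction_addCA retraction_add0r.
Qed.

Lemma retraction_addA : associative (retraction_add s).
Proof.
by move=> x y z; rewrite [y +s z]retraction_addC retraction_addCA retraction_addC.
Qed.

Lemma retraction_add_comm_monoid : comm_monoid (retraction_add s) zero.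
Proof.
split; [exact: retraction_addA | exact: retraction_addC |].
exact: retraction_add0l.
Qed.

Lemma retraction_add_semiring :
  semiring (retraction_add s) zero *%g (1 : adjoin0 H).
Proof.
split=> //; first exact: retraction_add_comm_monoid.
- by split; [apply: mulgA | apply: mul1g | apply: mulg1].
- by split; [apply: retraction_mulDl | move=> x y z; apply: retraction_mulDr].
- by split=> // [[a|]].
Qed.

End RetractionAddition.

(** [a + a = a + (a + 0) = a + 0 = a], since the translation by [a] is a
    retraction. *)
Lemma retraction_addxx (H : groupType) (Hab : forall a b : H, a * b = b * a)
    (s : adjoin0 H -> adjoin0 H) (c : H) (s0E : s zero = Some c) (a : H) :
  idempotent_fun s -> retraction_add s (Some a) (Some a) = Some a.
Proof.
move=> s_retr; have a0 := retraction_add0r Hab s0E (Some a).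
rewrite -{2}a0 !(retraction_addE Hab s0E).
rewrite [LHS](conjugate_idem _ s_retr).
by rewrite -(retraction_addE Hab s0E) a0.
Qed.

Theorem theorem2p8 (H : groupType) (Hab : forall a b : H, a * b = b * a)
    (s : adjoin0 H -> adjoin0 H) (s_retr : idempotent_fun s)
    (s_comm : commutes_with_conjugates s) (s0 : s zero <> zero) :
  [/\ comm_monoid (retraction_add s) zero,
      comm_semifield (retraction_add s) zero
        *%g (1 : adjoin0 H)
    & characteristic1 (retraction_add s) (1 : adjoin0 H)].
Proof.
case s0E: (s zero) => [c|] //.
split; first exact (retraction_add_comm_monoid Hab s0E s_comm).
- split; last exact: adjoin0_comm_group.
  exact (retraction_add_semiring Hab s0E s_comm).
- exact (retraction_addxx Hab s0E 1 s_retr).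
Qed.
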